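(* Let $p\ge1$ and let $k_1,\dots,k_p$ be positive real numbers. Let $T\subseteq\mathbb{R}$ be either a non-meagre set with the Baire property or a non-null Lebesgue measurable set. Then there exist a real $d$ and points $x_0<x_1<\cdots<x_p$ in $T$ such that $$x_i-x_{i-1}=k_i d,\qquad i=1,\dots,p .$$ *)

(* Defs.v *)
From HB Require Import structures.
From mathcomp Require Import all_boot all_order all_algebra.
From mathcomp Require Import all_classical all_reals all_analysis.

Set Implicit Arguments.
Unset Strict Implicit.
Unset Printing Implicit Defensive.

Import Order.TTheory GRing.Theory Num.Theory.
Import numFieldNormedType.Exports.

Local Open Scope classical_set_scope.
Local Open Scope ring_scope.

Definition nowhere_dense (X : topologicalType) (A : set X) : Prop :=
  interior (closure A) = set0.

Definition meagre (X : topologicalType) (A : set X) : Prop :=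
  exists F : nat -> set X,
    (forall n, nowhere_dense (F n)) /\ A = \bigcup_n F n.

Definition Baire_property (X : topologicalType) (A : set X) : Prop :=
  exists U : set X, open U /\ meagre (A `+` U).

(* [measurable] at the type [R] itself would mean Borel.  This is the
   Caratheodory sigma-algebra of the Lebesgue outer measure, on which
   [completed_lebesgue_measure] is defined; it equals the completion of the
   Borel sets by [completed_caratheodory_measurable]. *)
Definition Lebesgue_measurable (R : realType) (A : set R) : Prop :=
  ((@wlength R idfun)^*)%mu.-cara.-measurable A.

(* Main.v *)
Require Import Defs.
From HB Require Import structures.
From mathcomp Require Import all_boot all_order all_algebra.
From mathcomp Require Import all_classical all_reals all_analysis.
From mathcomp Require Import measurable_realfun.

Set Implicit Arguments.
Unset Strict Implicit.
Unset Printing Implicit Defensive.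

Import Order.TTheory GRing.Theory Num.Theory.
Import numFieldNormedType.Exports.

Local Open Scope classical_set_scope.
Local Open Scope ring_scope.

(** With [c j] the sum of the [k i] for [i < j], the conclusion asks for a
    copy [x + c j * d] of the finite pattern [c] inside [T], with [d > 0].
    In both cases much more is true: every sufficiently small [d], of either
    sign, admits such an [x]. The reason is that [T] fills some open set [U]
    up to a small exceptional set, and the points [x] for which some
    [x + c j * d] is exceptional form a finite union of translates of that
    exceptional set, still too small to exclude all [x].

    - Category ([Baire_property_near_pattern]): [T] agrees with a nonempty open
      [U] up to a meagre set. If [d] is small, then [x + c j * d] stays in [U]
      for all [x] in a fixed neighbourhood, and by Baire's theorem some [x]
      there avoids the finitely many translates of the meagre set.

    - Measure ([compact_near_pattern]): [T] contains a compact [K] of positive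
      measure ([Lebesgue_measurable_compact]). Take an open [U] containing [K]
      whose excess [U `\` K] is smaller than the measure of [K] divided by the
      number of pattern points. By compactness, [K + c j * d] lies in [U] for
      small [d]; a point [x] of [K] that fails for [j] then lies in a translate
      of [U `\` K], and by translation invariance these translates are too
      small to cover [K]. This is Steinhaus' argument. *)

(** Baire's theorem is needed for a family indexed by pairs of a natural number
    and a pattern point; such a family is enumerated by [unpickle], with the
    whole space at the indices that code nothing. *)
Lemma dense_bigcap_countType (R : realType) (X : completeNormedModType R)
    (I : countType) (A : I -> set X) :
  (forall i, open (A i) /\ dense (A i)) -> dense (\bigcap_i A i).
Proof.
move=> odA.
pose F n := if unpickle n is Some i then A i else setT.
have odF n : open (F n) /\ dense (F n).
  rewrite /F; case: unpickle => [i|]; first exact: odA.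
  by split; [exact: openT|move=> D D0 _; rewrite setIT].
suff -> : \bigcap_i A i = \bigcap_n F n by exact: Baire.
apply/seteqP; split=> x Ax.
  by move=> n _; rewrite /F; case: unpickle => [i|//]; exact: Ax.
by move=> i _; have := Ax (pickle i) Logic.I; rewrite /F pickleK.
Qed.

Lemma nowhere_dense_denseC (X : topologicalType) (A : set X) :
  nowhere_dense A -> dense (~` closure A).
Proof.
move=> A0 D [x Dx] oD; apply: contrapT => /nonemptyPn DA0.
suff: (closure A)° x by rewrite A0.
move: (x) Dx; rewrite -/(D `<=` (closure A)°) -open_subsetE//.
by rewrite -[X in _ `<=` X]setCK; exact/disjoints_subset.
Qed.

Lemma open_translate (R : realType) (t : R) (A : set R) :
  open A -> open [set x | A (x + t)].
Proof.
move=> oA; apply: (@open_comp _ _ (fun x : R => x + t)) => // x _.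
by apply: cvgD; [exact: cvg_id|exact: cvg_cst].
Qed.

Lemma dense_translate (R : realType) (t : R) (A : set R) :
  dense A -> dense [set x | A (x + t)].
Proof.
move=> dA D [y Dy] oD.
have [|x [/= Dx Ax]] := dA [set x | D (x - t)] _ (open_translate oD).
  by exists (y + t); rewrite /= addrK.
by exists (x - t); split; rewrite //= subrK.
Qed.

(** The two variables are near their limits jointly: the category case needs a
    neighbourhood of [a] that serves all small [d], and the measure case feeds
    this to the covering characterization of compactness. *)
Lemma near_translates (R : realType) (I : finType) (c : I -> R) (U : set R)
    (a : R) : open U -> U a ->
  \forall x \near a & d \near 0, forall j, U (x + c j * d).
Proof.
move=> oU Ua.
suff Uj j : \forall z \near (a, 0 : R), U (z.1 + c j * z.2).
  exact: (@filter_forall _ _ (fun j z => U (z.1 + c j * z.2)) _ _ Uj).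
have : (fun z : R * R => z.1 + c j * z.2) z @[z --> (a, 0)] --> a + c j * 0.
  by apply: cvgD; [exact: cvg_fst|apply: cvgM; [exact: cvg_cst|exact: cvg_snd]].
by rewrite mulr0 addr0; apply; exact: open_nbhs_nbhs.
Qed.

(** A point outside all the translates of the closures of the [F n] lies
    outside the translates of the meagre set [T `+` U], so membership in [U]
    passes to [T] at each [x + c j * d]. Passing to closures makes the sets to
    be intersected open. *)
Lemma Baire_property_near_pattern (R : realType) (I : finType) (c : I -> R)
    (T : set R) :
  ~ meagre T -> Baire_property T ->
  \forall d \near 0, exists x, forall j, T (x + c j * d).
Proof.
move=> nmT [U [oU [F [ndF TUF]]]].
have [a Ua] : U !=set0.
  apply: contrapT => /nonemptyPn U0; apply: nmT.
  by exists F; split=> //; rewrite -TUF U0 setY0.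
have [[V N] /= [nV nN] VNU] := near_translates c oU Ua.
apply: filterS nN => d Nd.
pose G (nj : nat * I) := [set x | (~` closure (F nj.1)) (x + c nj.2 * d)].
have /dense_bigcap_countType : forall nj, open (G nj) /\ dense (G nj).
  move=> [n j]; split.
    by apply: open_translate; rewrite openC; exact: closed_closure.
  by apply: dense_translate; exact: nowhere_dense_denseC.
move=> /(_ V°)[||x [/interior_subset Vx Gx]].
- by exists a.
- exact: open_interior.
exists x => j; apply: contrapT => nT.
have : (T `+` U) (x + c j * d) by right; split => //; exact: (VNU (x, d)).
rewrite TUF => -[n _ Fn].
by apply: (Gx (n, j) Logic.I); exact: subset_closure.
Qed.

Lemma measurable_fun_translate (R : realType) (t : R) :
  measurable_fun [set: measurableTypeR R]
    ((fun x => x + t) : measurableTypeR R -> measurableTypeR R).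
Proof.
apply: continuous_measurable_fun => x.
by apply: cvgD; [exact: cvg_id|exact: cvg_cst].
Qed.

Lemma measurable_translate (R : realType) (t : R)
    (A : set (measurableTypeR R)) :
  measurable A -> measurable [set x : measurableTypeR R | A (x + t)].
Proof.
move=> mA; rewrite -[X in measurable X]setTI.
by apply: measurable_fun_translate.
Qed.

(** The left-hand side is the pushforward of Lebesgue measure under a
    translation; being a measure with the same values on half-open intervals,
    it is Lebesgue measure. *)
Lemma lebesgue_measure_translate (R : realType) (t : R)
    (A : set (measurableTypeR R)) : measurable A ->
  lebesgue_measure [set x : R | A (x + t)] = lebesgue_measure A.
Proof.
move=> mA; pose f (x : measurableTypeR R) : measurableTypeR R := x + t.
have mf : measurable_fun setT f := measurable_fun_translate t.
(* bundled with its measurability, so that the pushforward is a measure *)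
pose f' := mfun_Sub (mem_set mf).
rewrite -[LHS]/(pushforward lebesgue_measure f' A).
apply/esym/lebesgue_measure_unique => //= _ [[a b]] _ <-.
rewrite /pushforward.
have -> : f @^-1` `]a, b]%classic = `]a - t, b - t]%classic.
  by apply/seteqP; split=> x /=; rewrite !in_itv/= ltrBlDr lerBrDr.
by rewrite !lebesgue_measure_itv/= !lte_fin ltrD2r -!EFinB opprB addrA subrK.
Qed.

(** If no [x] worked, each point of [K] would lie in one of the [#|I|]
    translates of [U `\` K], whose total measure is less than that of [K]. *)
Lemma compact_near_pattern (R : realType) (I : finType) (c : I -> R)
    (K : set R) : compact K -> (0 < lebesgue_measure K)%E ->
  \forall d \near 0, exists x, forall j, K (x + c j * d).
Proof.
move=> cK K0.
pose mu : measure (measurableTypeR R) R := @lebesgue_measure R.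
have mK : measurable (K : set (measurableTypeR R)) by exact: compact_measurable.
have Koo := compact_finite_measure cK.
have [m Km] : exists m, lebesgue_measure K = m%:E.
  by exists (fine (lebesgue_measure K)); rewrite fineK// ge0_fin_numE// ltW.
have m0 : 0 < m by move: K0; rewrite Km lte_fin.
(* the successor keeps the denominator nonzero when [I] is empty *)
have e0 : 0 < m / #|I|.+1%:R by rewrite divr_gt0.
have [U [oU KU UKe]] := lebesgue_regularity_outer mK Koo e0.
have mU : measurable (U : set (measurableTypeR R)) by exact: open_measurable.
have mUK : measurable (U `\` K : set (measurableTypeR R)) by exact: measurableD.
have Ud : \forall d \near 0, K `<=` [set x | forall j, U (x + c j * d)].
  apply: ((compact_near_coveringP K).1 cK R (nbhs 0)
    (fun d x => forall j, U (x + c j * d))) => x Kx.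
  exact: near_translates oU (KU _ Kx).
apply: filterS Ud => d KUd; apply: contrapT => noK.
pose B j := [set x : measurableTypeR R | (U `\` K) (x + c j * d)].
have KB : K `<=` \bigcup_j B j.
  move=> x Kx; apply: contrapT => nB; apply: noK; exists x => j.
  by apply: contrapT => nK; apply: nB; exists j => //; split => //; exact: KUd.
have mB j : measurable (B j) by exact: measurable_translate.
have [u muUK] : exists u, mu (U `\` K) = u%:E.
  exists (fine (mu (U `\` K))); rewrite fineK// ge0_fin_numE ?measure_ge0//.
  exact: lt_trans UKe (ltry _).
have um : u < m / #|I|.+1%:R by rewrite -lte_fin -muUK.
have := content_sub_fsum (mu : {content set _ -> \bar R})
  finite_finset (fun j _ => mB j) mK KB.
rewrite (fsbigE (enum I))//=; first last.
- by move=> j _; rewrite mem_enum.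
- exact: enum_uniq.
rewrite (eq_bigr (fun=> u%:E)) => [|j _]; last first.
  by rewrite -muUK; exact: lebesgue_measure_translate.
rewrite (eq_bigl xpredT) => [|j]; last by rewrite in_setT.
rewrite big_enum/= sumEFin Km lee_fin sumr_const.
apply/negP; rewrite -ltNge -mulr_natr.
rewrite (@le_lt_trans _ _ (m / #|I|.+1%:R * #|I|%:R))//.
  by rewrite ler_wpM2r// ltW.
by rewrite mulrAC ltr_pdivrMr// ltr_pM2l// ltr_nat.
Qed.

(** A Lebesgue measurable set is a Borel set [A] together with a negligible
    set. If [A] were null, the whole would be null; so [A] has positive measure
    and inner regularity of Borel sets applies to it. *)
Lemma Lebesgue_measurable_compact (R : realType) (T : set R) :
  Lebesgue_measurable T -> completed_lebesgue_measure T <> 0%E ->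
  exists K, [/\ compact K, K `<=` T & (0 < lebesgue_measure K)%E].
Proof.
rewrite /Lebesgue_measurable -completed_caratheodory_measurable.
rewrite g_sigma_completed_algebra_genE => -[A mA [N negN <-]] AN0.
have A0 : (0 < lebesgue_measure A)%E.
  rewrite lt0e measure_ge0 andbT; apply: contra_notN AN0 => /eqP A0.
  have [B [mB B0 NB]] := negN.
  apply/eqP; rewrite eq_le measure_ge0 andbT.
  have ANB : A `|` N `<=` A `|` B by exact: setUS.
  rewrite (le_trans (le_outer_measure (@wlength R idfun)^*%mu _ _ ANB))//.
  rewrite (le_trans (outer_measureU2 (@wlength R idfun)^*%mu A B))//.
  (* Lebesgue measure is by definition the restriction of this outer measure *)
  suff : (lebesgue_measure A + lebesgue_measure B <= 0)%E by [].
  by rewrite A0 B0 adde0.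
move: A0; rewrite lebesgue_regularity_inner_sup//.
move=> /ereal_sup_gt[_ [K [cK KA] <-] K0].
by exists K; split => // x /KA; left.
Qed.

Theorem theoremR (R : realType) (p : nat) (hp : (1 <= p)%N)
    (k : 'I_p -> R) (hk : forall i, 0 < k i) (T : set R)
    (hT : (~ meagre T /\ Baire_property T) \/
          (Lebesgue_measurable T /\ completed_lebesgue_measure T <> 0%E)) :
  exists (d : R) (x : 'I_p.+1 -> R),
    [/\ forall j : 'I_p.+1, T (x j),
        forall i : 'I_p, x (widen_ord (leqnSn p) i) < x (lift ord0 i) &
        forall i : 'I_p,
          x (lift ord0 i) - x (widen_ord (leqnSn p) i) = k i * d].
Proof.
pose c (j : 'I_p.+1) := \sum_(i < p | (i < j)%N) k i.
have cS i : c (lift ord0 i) = c (widen_ord (leqnSn p) i) + k i.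
  rewrite /c (bigD1 i)/=; last by rewrite /bump.
  rewrite addrC; congr (_ + _); apply: eq_bigl => i' /=.
  by rewrite /bump add1n ltnS ltn_neqAle andbC.
have Tc : \forall d \near 0, exists x, forall j, T (x + c j * d).
  case: hT => [[nmT bT]|[mT T0]]; first exact: Baire_property_near_pattern.
  have [K [cK KT K0]] := Lebesgue_measurable_compact mT T0.
  apply: filterS (compact_near_pattern c cK K0) => d [x Kx].
  by exists x => j; exact: KT.
have [e /= e0 Te] := Tc.
have [|x Tx] := Te (e / 2).
  by rewrite /= sub0r normrN gtr0_norm ?divr_gt0// ltr_pdivrMr// ltr_pMr// ltr1n.
exists (e / 2), (fun j => x + c j * (e / 2)).
have dx i : (x + c (lift ord0 i) * (e / 2)) -
    (x + c (widen_ord (leqnSn p) i) * (e / 2)) = k i * (e / 2).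
  by rewrite cS mulrDl addrA [X in X - _]addrC addrK.
split => // i.
by rewrite -subr_gt0 dx mulr_gt0// divr_gt0.
Qed.
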